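(* Let $n\geq 16$ with $n\equiv 0\pmod 4$, $r=4$, and $t=n-11$. Let $V$ be the set of $n$ vertices $\ell,\nu,\mu,i,b,g,a,d,h,c,e,f_1,\dots,f_t$, and consider the labelled graph on $V$ with edges: label $0$ on $\{\ell,\nu\},\{g,h\},\{a,c\}$; label $1$ on $\{\nu,\mu\},\{h,i\},\{c,b\}$; the edge $\{d,e\}$ carrying the three labels $0,1,3$; label $2$ on $\{a,d\},\{c,e\},\{\mu,i\},\{b,f_1\}$ and on $\{f_s,f_{s+1}\}$ for even $s$ with $1\leq s\leq t-1$; label $3$ on $\{g,a\},\{h,c\},\{i,b\}$ and on $\{f_s,f_{s+1}\}$ for odd $s$ with $1\leq s\leq t-1$. Then $G\cong A_n$ and $(G,(\rho_0,\rho_1,\rho_2,\rho_3))$ is a string C-group of rank 4 with Schläfli type $\{3,12,\mathrm{lcm}(n-8,6)\}$.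
   Context: A string group generated by involutions (sggi) of rank $r$ is a pair $(G,(\rho_0,\dots,\rho_{r-1}))$ where $\rho_0,\dots,\rho_{r-1}$ are involutions generating the group $G$ such that $(\rho_i\rho_j)^2=1$ whenever $|i-j|\geq 2$. It is a string C-group if in addition it satisfies the intersection property: for all $J,K\subseteq\{0,\dots,r-1\}$, $\langle \rho_j : j\in J\rangle\cap\langle\rho_k : k\in K\rangle=\langle \rho_j : j\in J\cap K\rangle$. The Schläfli type is $\{p_1,\dots,p_{r-1}\}$ where $p_i$ is the order of $\rho_{i-1}\rho_i$. Labelled-graph convention: the vertex set $V$ is finite, and each edge $\{a,b\}$ ($a\neq b$) carries one or more labels from $\{0,\dots,r-1\}$, the edges carrying any given label being pairwise disjoint; $\rho_k$ denotes the permutation of $V$ equal to the product of the transpositions $(a\,b)$ over all edges $\{a,b\}$ carrying label $k$, and $G=\langle\rho_0,\dots,\rho_{r-1}\rangle\leq \mathrm{Sym}(V)$. *)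

(* Defs.v *)
From HB Require Import structures.
From mathcomp Require Import all_boot all_fingroup all_solvable.
Set Implicit Arguments. Unset Strict Implicit. Unset Printing Implicit Defensive.
Local Open Scope group_scope.

Definition gen_sub (gT : finGroupType) (r : nat) (rho : nat -> gT) (J : {set 'I_r})
  : {set gT} := <<[set rho (val j) | j in J]>>.

Definition sggi (gT : finGroupType) (G : {set gT}) (r : nat) (rho : nat -> gT) : Prop :=
  [/\ G = gen_sub rho [set: 'I_r],
      (forall i, i < r -> rho i ^+ 2 = 1 /\ rho i != 1)
    & (forall i j, i < r -> j < r -> (i.+1 < j) || (j.+1 < i) ->
         (rho i * rho j) ^+ 2 = 1)].

Definition intersection_property (gT : finGroupType) (r : nat) (rho : nat -> gT) : Prop :=
  forall J K : {set 'I_r}, gen_sub rho J :&: gen_sub rho K = gen_sub rho (J :&: K).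

Definition string_C_group (gT : finGroupType) (G : {set gT}) (r : nat) (rho : nat -> gT)
  : Prop := sggi G r rho /\ intersection_property r rho.

Definition schlafli (gT : finGroupType) (r : nat) (rho : nat -> gT) : seq nat :=
  [seq #[rho i.-1 * rho i] | i <- iota 1 r.-1].

(* Vertices are 'I_n, numbered:
   l=0, nu=1, mu=2, i=3, b=4, g=5, a=6, d=7, h=8, c=9, e=10, f_s = 10+s (1<=s<=t),
   with t = n - 11, so f_t = n-1. *)

Definition transp (n : nat) (e : nat * nat) : {perm 'I_n} :=
  match insub e.1, insub e.2 with
  | Some x, Some y => tperm x y
  | _, _ => 1
  end.

Definition f_edges (n : nat) (p : bool) : seq (nat * nat) :=
  [seq ((10 + s)%N, (11 + s)%N) | s <- iota 1 ((n - 11) - 1)%N & odd s == p].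

Definition edges (n k : nat) : seq (nat * nat) :=
  match k with
  | 0 => [:: (0, 1); (5, 8); (6, 9); (7, 10)]%N
  | 1 => [:: (1, 2); (8, 3); (9, 4); (7, 10)]%N
  | 2 => [:: (6, 7); (9, 10); (2, 3); (4, 11)]%N ++ f_edges n false
  | 3 => [:: (5, 6); (8, 9); (3, 4); (7, 10)]%N ++ f_edges n true
  | _ => [::]
  end.

Definition rho (n : nat) (k : nat) : {perm 'I_n} :=
  \prod_(e <- edges n k) transp n e.

Definition Ggen (n : nat) : {group {perm 'I_n}} :=
  [group of gen_sub (rho n) [set: 'I_4]].

(* Main.v *)
Require Import Defs.
From HB Require Import structures.
From mathcomp Require Import all_boot all_fingroup all_solvable.
From mathcomp Require Import zify.

(** Intersection property.  Write P(J) for the subgroup generated by the rho_j,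
    j in J.  If P[a,b) and P[a+1,b+1) meet in P[a+1,b) for all a < b, then the
    property holds, by induction on the length of intervals of indices.  These
    six conditions are checked by coset enumeration: P[0,b) is covered by few
    cosets of P[1,b), all but the trivial one move the vertex 0, and P[1,b+1)
    fixes it; the pair (1,3) also uses that P{2,3} preserves {5,..,10}.

    Alternating group.  (rho_1 rho_2)^6 = (1 8)(2 3).  Its conjugates by rho_0
    and rho_3 share a single vertex, so the square of their product is a
    3-cycle.  Conjugation yields (0 1 2) and (0 1 10), and, since rho_2 and
    rho_3 fix 0 and 1, then (0 1 m) for every m.

    Last entry of the type.  rho_2 rho_3 acts on two paths whose edges are
    labelled 2 and 3 alternately, with n - 8 and 6 vertices, as a cycle on each. *)

Set Implicit Arguments. Unset Strict Implicit. Unset Printing Implicit Defensive.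
Local Open Scope group_scope.

(** * Intersection property from intervals of indices *)

Canonical gen_sub_group (gT : finGroupType) (r : nat) (rho : nat -> gT)
  (J : {set 'I_r}) := [group of gen_sub rho J].

Definition IP_on (gT : finGroupType) (r : nat) (rho : nat -> gT) (I : {set 'I_r}) :=
  forall J K : {set 'I_r}, J \subset I -> K \subset I ->
    gen_sub rho J :&: gen_sub rho K \subset gen_sub rho (J :&: K).

Definition index_range (r a b : nat) : {set 'I_r} := [set i : 'I_r | a <= i < b].

Section IntersectionProperty.

Context (gT : finGroupType) (r : nat) (rho : nat -> gT).
Local Notation P := (@gen_sub gT r rho).

Lemma gen_subS (J K : {set 'I_r}) : J \subset K -> P J \subset P K.
Proof. by move=> sJK; rewrite genS ?imsetS. Qed.

Lemma gen_sub_mem (J : {set 'I_r}) (j : 'I_r) : j \in J -> rho j \in P J.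
Proof. by move=> Jj; rewrite mem_gen //; apply: imset_f. Qed.

Lemma gen_sub0 : P set0 = 1.
Proof. by rewrite /gen_sub imset0 gen0. Qed.

Lemma gen_sub_min (J : {set 'I_r}) (H : {group gT}) :
  (forall j, j \in J -> rho (val j) \in H) -> P J \subset H.
Proof. by move=> sJH; rewrite gen_subG; apply/subsetP => _ /imsetP[j Jj ->]; exact: sJH. Qed.

Lemma IP_of_removal (I : {set 'I_r}) :
    (forall (J : {set 'I_r}) (j : 'I_r), J \subset I -> j \in J ->
       P J :&: P (I :\ j) \subset P (J :\ j)) ->
  IP_on rho I.
Proof.
move=> rem J K sJI sKI; apply/subsetP => g /setIP[].
have [m] := ubnP #|J :\: K|; elim: m J sJI => // m IHm J sJI ltJm Jg Kg.
have [/eqP|[j /setDP[Jj K'j]]] := set_0Vmem (J :\: K).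
  by rewrite setD_eq0 => /setIidPl->.
have -> : J :&: K = (J :\ j) :&: K.
  by apply/setP=> k; rewrite !inE; case: eqVneq => //= ->; rewrite (negPf K'j) andbF.
have sKIj : K \subset I :\ j.
  by apply/subsetP=> k Kk; rewrite !inE (subsetP sKI) // andbT; apply: contraNneq K'j => <-.
apply: IHm => //; first exact: subset_trans (subsetDl _ _) sJI.
  rewrite -ltnS; apply: leq_ltn_trans ltJm; rewrite setDDl setUC -setDDl.
  by rewrite (cardsD1 j (J :\: K)) inE Jj K'j.
by apply: (subsetP (rem J j sJI Jj)); rewrite inE Jg (subsetP (gen_subS sKIj)).
Qed.

(** Indices on different sides of the missing i differ by at least 2, so the two parts commute. Both
    orders of the factors serve the two mirror cases of [IP_interval]. *)
Lemma gen_sub_split (J : {set 'I_r}) (i : nat) :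
    (forall i j, i < r -> j < r -> i.+1 < j -> commute (rho i) (rho j)) ->
    (forall j, j \in J -> (j : nat) != i) ->
  P J = P [set j in J | j < i] * P [set j in J | i < j]
  /\ P J = P [set j in J | i < j] * P [set j in J | j < i].
Proof.
move=> comm Ji.
set L := [set j in J | j < i]; set R := [set j in J | i < j].
have JE : J = L :|: R.
  by apply/setP=> j; rewrite !inE -andb_orr -neq_ltn; case Jj: (j \in J) => //=; rewrite Ji.
have cLR : P R \subset 'C(P L).
  rewrite gen_subG; apply/subsetP => _ /imsetP[j Rj ->].
  rewrite -sub1set centsC gen_subG; apply/subsetP => _ /imsetP[k Lk ->].
  apply/centP => _ /set1P ->; apply: comm; rewrite ?ltn_ord //.
  by move: Rj Lk; rewrite !inE /=; lia.
have PE : P J = P L <*> P R by rewrite {1}JE /gen_sub imsetU joing_idl joing_idr.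
by rewrite PE; split; [rewrite cent_joinEr | rewrite joingC cent_joinEr // centsC].
Qed.

(* If xy = cd, with x in P L, y in P R, c in P C and d in P D, then
   c^-1 x = d y^-1 lies in P X and in P Y, hence in P (C :|: L) and in P D, and so
   x = c (c^-1 x) lies in P (C :|: D), which does not involve j. *)
Lemma removal_step (X Y C D L R J : {set 'I_r}) (j : 'I_r) (g : gT) :
    IP_on rho X -> IP_on rho Y -> P X :&: P Y \subset P (X :&: Y) ->
    L \subset X -> C \subset X -> D \subset Y -> R \subset D ->
    L :|: R \subset J -> j \notin C -> j \notin D ->
    g \in P L * P R -> g \in P C * P D ->
  g \in P (J :\ j).
Proof.
move=> IX IY IXY sLX sCX sDY sRD sLRJ nCj nDj /mulsgP[x y Lx Ry ->] /mulsgP[c d Cc Dd eg].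
set E := C :|: L; set m := c^-1 * x.
have sEX : E \subset X by rewrite subUset sCX.
have Em : m \in P E.
  by rewrite groupM ?groupV ?(subsetP (gen_subS _) _ Cc) ?(subsetP (gen_subS _) _ Lx)
             ?subsetUl ?subsetUr.
have Dm : m \in P D.
  have -> : m = d * y^-1.
    by apply: (mulgI c); apply: (mulIg y); rewrite /m mulKVg eg !mulgA mulgKV.
  by rewrite groupM ?groupV // (subsetP (gen_subS sRD)).
have EYm : m \in P (E :&: Y).
  have : m \in P (X :&: Y).
    by rewrite (subsetP IXY) // inE (subsetP (gen_subS sEX)) // (subsetP (gen_subS sDY)).
  move=> XYm; have := subsetP (IX E (X :&: Y) sEX (subsetIl _ _)) m.
  by rewrite inE Em XYm setIA (setIidPl sEX) => ->.
have EDm : m \in P (E :&: D).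
  have := subsetP (IY (E :&: Y) D (subsetIr _ _) sDY) m.
  by rewrite inE EYm Dm -setIA (setIidPr sDY) => ->.
set F := C :|: (E :&: D).
have sFX : F \subset X by rewrite subUset sCX (subset_trans (subsetIl _ _)).
have LFx : x \in P (L :&: F).
  have Fx : x \in P F.
    rewrite -(mulKVg c x) -/m groupM //.
      by rewrite (subsetP (gen_subS _) _ Cc) // subsetUl.
    by rewrite (subsetP (gen_subS _) _ EDm) // subsetUr.
  by have := subsetP (IX L F sLX sFX) x; rewrite inE Lx Fx => ->.
move: sLRJ; rewrite subUset => /andP[sLJ sRJ].
apply: groupM; [apply: subsetP LFx | apply: subsetP Ry]; apply: gen_subS.
  apply/subsetP=> k; rewrite !inE => /andP[Lk Fk]; rewrite (subsetP sLJ) // andbT.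
  by apply: contraTneq Fk => ->; rewrite (negPf nCj) (negPf nDj) andbF.
apply/subsetP=> k Rk; rewrite !inE (subsetP sRJ) // andbT.
by apply: contraNneq nDj => <-; apply: (subsetP sRD).
Qed.

Lemma IP_interval :
    (forall i j, i < r -> j < r -> i.+1 < j -> commute (rho i) (rho j)) ->
    (forall a b, a < b < r ->
       P (index_range r a b) :&: P (index_range r a.+1 b.+1) \subset P (index_range r a.+1 b)) ->
  forall m a, IP_on rho (index_range r a (a + m)).
Proof.
move=> comm base; elim/ltn_ind=> -[|[|m]] IHm a.
- move=> J K sJ _; have -> : J = set0.
    apply/eqP; rewrite -subset0 (subset_trans sJ) //.
    by apply/subsetP=> i; rewrite !inE addn0; lia.
  by rewrite set0I subsetIl.
- apply: IP_of_removal => J j sJ Jj.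
  have -> : index_range r a (a + 1) :\ j = set0.
    apply/setP=> i; rewrite !inE; have := subsetP sJ j Jj; rewrite inE => aj.
    by apply/negP=> /andP[/eqP ij ai]; case: ij; apply: val_inj => /=; lia.
  by rewrite gen_sub0 (subset_trans (subsetIr _ _)) // sub1G.
set b := a + m.+1; rewrite addnS -/b; set X := index_range r a b; set Y := index_range r a.+1 b.+1.
have IX : IP_on rho X by apply: IHm.
have IY : IP_on rho Y by rewrite /Y -[b.+1]/(a.+1 + m.+1); apply: IHm.
have XYE : X :&: Y = index_range r a.+1 b by apply/setP=> i; rewrite !inE; lia.
have IXY : P X :&: P Y \subset P (X :&: Y).
  rewrite XYE; have [br|rb] := ltnP b r; first by apply: base; lia.
  (* An interval may run past the last index; then b is not an index, and cutting it off changes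
     nothing. *)
  suff -> : index_range r a.+1 b = Y by rewrite subsetIr.
  by apply/setP=> i; rewrite !inE; have := ltn_ord i; lia.
have IYX : P Y :&: P X \subset P (Y :&: X) by rewrite setIC [Y :&: X]setIC.
apply: IP_of_removal => J j sJ Jj.
have [/eqP sIJ|] := boolP (J == index_range r a b.+1); first by rewrite sIJ subsetIr.
rewrite eqEsubset sJ /= => /subsetPn[i]; rewrite inE => iI nJi.
apply/subsetP=> g /setIP[].
have nJE k : k \in J -> (k : nat) != i by move=> Jk; apply: contraNneq nJi => /ord_inj <-.
have [EJ EJ'] := gen_sub_split comm nJE.
have nIE k : k \in index_range r a b.+1 :\ j -> (k : nat) != j.
  by rewrite !inE => /andP[/eqP nkj _]; apply/eqP=> /ord_inj.
have [EI EI'] := gen_sub_split comm nIE.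
have Ij := subsetP sJ j Jj; rewrite inE in Ij.
have sJE k : k \in J -> a <= k < b.+1 by move/(subsetP sJ); rewrite inE.
(* J splits at the missing i, the interval at the removed j. If j < i, the part of J above i lies in
   the part of the interval above j; the other case is the mirror image, with X and Y exchanged. *)
have := nJE j Jj; rewrite neq_ltn => /orP[ji|ij].
  rewrite EJ EI; apply: (@removal_step X Y) => //.
  all: try by rewrite !inE ltnn ?andbF.
  all: try by apply/subsetP=> k; rewrite !inE => /andP[/sJE]; lia.
  all: try by apply/subsetP=> k; rewrite !inE => /andP[/andP[_ ]]; lia.
    apply/subsetP=> k; rewrite !inE -(inj_eq (@ord_inj r)) => /andP[/sJE]; lia.
  by apply/subsetP=> k; rewrite !inE => /orP[] /andP[].
rewrite EJ' EI'; apply: (@removal_step Y X) => //.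
  all: try by rewrite !inE ltnn ?andbF.
  all: try by apply/subsetP=> k; rewrite !inE => /andP[/sJE]; lia.
  all: try by apply/subsetP=> k; rewrite !inE => /andP[/andP[_ ]]; lia.
  apply/subsetP=> k; rewrite !inE -(inj_eq (@ord_inj r)) => /andP[/sJE]; lia.
by apply/subsetP=> k; rewrite !inE => /orP[] /andP[].
Qed.

Lemma intersection_property_interval :
    (forall i j, i < r -> j < r -> i.+1 < j -> commute (rho i) (rho j)) ->
    (forall a b, a < b < r ->
       P (index_range r a b) :&: P (index_range r a.+1 b.+1) \subset P (index_range r a.+1 b)) ->
  intersection_property r rho.
Proof.
move=> comm base J K; apply/eqP; rewrite eqEsubset subsetI !gen_subS ?subsetIl ?subsetIr // !andbT.
by apply: (IP_interval comm base (m := r) (a := 0)); apply/subsetP=> i _; rewrite inE add0n ltn_ord.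
Qed.

End IntersectionProperty.

(** * Action of the generators on the vertices *)

Definition swap (a b x : nat) : nat := if x == a then b else if x == b then a else x.

Lemma transpE n a b (x : 'I_n) : a < n -> b < n -> (transp n (a, b) x : nat) = swap a b x.
Proof.
move=> an bn; rewrite /transp /= !insubT /swap.
by case: tpermP => [->|->|/eqP xa /eqP xb] /=; rewrite ?eqxx //;
  [case: eqP | rewrite -!(inj_eq (@ord_inj n)) /= in xa xb; rewrite (negPf xa) (negPf xb)].
Qed.

Definition matching (s : seq (nat * nat)) :=
  forall e f, e \in s -> f \in s ->
    [|| e.1 == f.1, e.1 == f.2, e.2 == f.1 | e.2 == f.2] -> e = f.

Lemma prod_transp_fix n (s : seq (nat * nat)) (x : 'I_n) :
    (forall e, e \in s -> [/\ e.1 < n, e.2 < n, e.1 != x & e.2 != x]) ->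
  (\prod_(e <- s) transp n e) x = x.
Proof.
elim: s => [|[a b] s IHs] sP; first by rewrite big_nil perm1.
have [/= an bn ax bx] := sP (a, b) (mem_head _ _).
rewrite big_cons permM; have -> : transp n (a, b) x = x.
  by apply: ord_inj; rewrite transpE // /swap eq_sym (negPf ax) eq_sym (negPf bx).
by apply: IHs => e se; apply: sP; rewrite in_cons se orbT.
Qed.

(** Only the factor of the edge at x moves x, and no later factor moves y. A repeated edge would
    cancel, and [matching] does not exclude it; [uniq] does. *)
Lemma prod_transp_edge n (s : seq (nat * nat)) (x y : 'I_n) :
    matching s -> uniq s -> (forall e, e \in s -> e.1 < n /\ e.2 < n) ->
    ((x : nat, y : nat) \in s) || ((y : nat, x : nat) \in s) ->
  (\prod_(e <- s) transp n e) x = y.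
Proof.
elim: s => [|[a b] s IHs] //= ms /andP[nabs us] sn xys.
have [/= an bn] := sn (a, b) (mem_head _ _).
have ns e : e \in s -> e.1 < n /\ e.2 < n by move=> se; apply: sn; rewrite in_cons se orbT.
have nshare e : e \in s -> [/\ e.1 != a, e.1 != b, e.2 != a & e.2 != b].
  move=> se; apply/and4P; apply: contraNT nabs => nd; suff -> : (a, b) = e by [].
  apply: ms; rewrite ?mem_head ?in_cons ?se ?orbT //=.
  by move: nd; rewrite !negb_and !negbK !(eq_sym e.1) !(eq_sym e.2); do 4 case: eqP => //=.
rewrite big_cons permM.
have [xyab|xyab] := boolP (((x : nat, y : nat) == (a, b)) || ((y : nat, x : nat) == (a, b))).
  have -> : transp n (a, b) x = y.
    apply: ord_inj; rewrite transpE // /swap.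
    by case/orP: xyab => /eqP[-> ->]; rewrite eqxx //; case: eqP.
  apply: prod_transp_fix => e se; have [e1 e2] := ns e se; have [] := nshare e se.
  by case/orP: xyab => /eqP[E1 E2]; rewrite ?E1 ?E2.
have xys' : ((x : nat, y : nat) \in s) || ((y : nat, x : nat) \in s).
  by move: xys xyab; rewrite !in_cons; case: (_ == _); case: (_ == _) => //=; rewrite ?orbT.
have -> : transp n (a, b) x = x.
  apply: ord_inj; rewrite transpE // /swap.
  by case/orP: xys' => /nshare[] /= x1 x2 x3 x4;
    rewrite ?(negPf x1) ?(negPf x2) ?(negPf x3) ?(negPf x4).
apply: IHs => // e f se sf; apply: ms; rewrite in_cons ?se ?sf orbT //.
Qed.

Lemma mem_f_edges n p e : e \in f_edges n p ->
  [/\ 10 < e.1, e.2 = e.1.+1, odd e.1 = p & e.2 < n].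
Proof.
case/mapP=> s; rewrite mem_filter mem_iota => /andP[/eqP sp sn] ->; split=> //=; lia.
Qed.

Lemma f_edges_mem n p x : 10 < x -> x.+1 < n -> odd x = p -> (x, x.+1) \in f_edges n p.
Proof.
move=> x10 xn xp; apply/mapP; exists (x - 10)%N; last by congr (_, _); lia.
by rewrite mem_filter mem_iota; lia.
Qed.

Lemma uniq_f_edges n p : uniq (f_edges n p).
Proof. by rewrite map_inj_uniq ?filter_uniq ?iota_uniq // => s s' [] /addnI. Qed.

Definition edge_table (k : nat) : seq nat :=
  match k with
  | 0 => [:: 1; 0; 2; 3; 4; 8; 9; 10; 5; 6; 7; 11]%N
  | 1 => [:: 0; 2; 1; 8; 9; 5; 6; 10; 3; 4; 7; 11]%N
  | 2 => [:: 0; 1; 3; 2; 11; 5; 7; 6; 8; 10; 9; 4]%N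
  | _ => [:: 0; 1; 2; 4; 3; 6; 5; 10; 9; 8; 7; 12]%N
  end.

(** The table covers the irregular part of the graph; from 12 on, parity decides to which neighbour
    on the f-path a label leads. *)
Definition edge_act (k x : nat) : nat :=
  if x < 12 then nth 0 (edge_table k) x else
  match k with
  | 0 | 1 => x
  | 2 => if odd x then x.-1 else x.+1
  | _ => if odd x then x.+1 else x.-1
  end.

Lemma edge_act_ge k x : 11 < x ->
  edge_act k x = match k with
                 | 0 | 1 => x
                 | 2 => if odd x then x.-1 else x.+1
                 | _ => if odd x then x.+1 else x.-1
                 end.
Proof. by move=> x12; rewrite /edge_act ltnNge x12. Qed.

Section Graph.

Context (n : nat) (hn : 16 <= n) (n_even : ~~ odd n).

Lemma edges_lt k e : e \in edges n k -> e.1 < n /\ e.2 < n.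
Proof.
have fP p : e \in f_edges n p -> e.1 < n /\ e.2 < n by move=> /mem_f_edges[]; lia.
case: k => [|[|[|[|k]]]]; rewrite /edges ?mem_cat //; try (case/orP=> [|/fP//]);
  by rewrite !inE => /or4P[] /eqP->; split; rewrite /=; lia.
Qed.

Lemma edges_neq k e : e \in edges n k -> e.1 != e.2.
Proof.
have fP p : e \in f_edges n p -> e.1 != e.2 by move=> /mem_f_edges[]; lia.
case: k => [|[|[|[|k]]]]; rewrite /edges ?mem_cat //; try (case/orP=> [|/fP//]);
  by rewrite !inE => /or4P[] /eqP->.
Qed.

Lemma edges_uniq k : uniq (edges n k).
Proof.
case: k => [|[|[|[|k]]]] //=; rewrite uniq_f_edges !inE /= !andbT;
by do !(apply/andP; split); apply/negP => /mem_f_edges[].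
Qed.

Lemma edges_matching k : matching (edges n k).
Proof.
have fP p e : e \in f_edges n p -> [/\ 10 < e.1, e.2 = e.1.+1 & odd e.1 = p].
  by case/mem_f_edges.
move=> [e1 e2] [f1 f2] + + sh; rewrite /= in sh.
case: k => [|[|[|[|k]]]]; rewrite /edges ?mem_cat //.
all: try (case/orP=> [|/fP[/= ? ? ?]]).
all: rewrite ?inE; try (case/or4P=> /eqP[? ?]).
all: try (case/orP=> [|/fP[/= ? ? ?]]).
all: rewrite ?inE; try (case/or4P=> /eqP[? ?]).
all: by congr (_, _); lia.
Qed.

(* edge_act describes infinite tails of edges labelled 2 and 3; in the graph the
   last vertex n-1 has no edge labelled 3. *)
Definition edge_actn (k x : nat) : nat := if (k == 3) && (x == n.-1) then x else edge_act k x.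

Lemma edge_actn_edge k x : k < 4 -> x < n ->
  [|| (x, edge_actn k x) \in edges n k, (edge_actn k x, x) \in edges n k
    | (edge_actn k x == x) && all (fun e => (e.1 != x) && (e.2 != x)) (edges n k)].
Proof.
have fN p m : m < 12 -> (m == 11) ==> ~~ p -> all (fun e => (e.1 != m) && (e.2 != m)) (f_edges n p).
  by move=> m12 m11; apply/allP=> e /mem_f_edges[]; lia.
move=> k4 xn; rewrite /edge_actn /edge_act; have [x12|x12] := ltnP x 12.
  have -> : (x == n.-1) = false by lia.
  by move: k x k4 x12 {xn}; do 4 (try case); rewrite // ?andbF;
    do 12 (try case=> //); move=> *; rewrite /= ?in_cons ?fN ?f_edges_mem //= ?orbT //; lia.
case: k k4 => [|[|[|[|]]]] // _; rewrite ?andbF /=.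
- by apply/or3P; apply: Or33; lia.
- by apply/or3P; apply: Or33; lia.
- rewrite !in_cons; case ox: (odd x).
    have := @f_edges_mem n false x.-1; rewrite prednK; last lia.
    by move=> -> //; rewrite ?orbT //; lia.
  by rewrite (@f_edges_mem n false x) ?orbT //; lia.
(* Since n is even, an f-edge ending at n-1 would start at an even number, while those labelled 3
   start at odd ones. *)
have [xn1|xn1] := eqVneq x n.-1.
  apply/or3P; apply: Or33; rewrite eqxx !andbA /=.
  apply/andP; split; first lia; apply/allP=> -[e1 e2] /mem_f_edges[/= ? ? oe1 ?].
  have [e2x|] := eqVneq e2 x; last lia.
  have E : n = e1.+2 by lia.
  by move: n_even; rewrite E /= => /negPn; rewrite oe1.
rewrite !in_cons; case ox: (odd x).
  by rewrite (@f_edges_mem n true x) ?orbT //; lia.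
have := @f_edges_mem n true x.-1; rewrite prednK; last lia.
by move=> -> //; rewrite ?orbT //; lia.
Qed.

Lemma edge_actn_lt k x : k < 4 -> x < n -> edge_actn k x < n.
Proof.
move=> k4 xn; have := edge_actn_edge k4 xn.
case/or3P=> [/edges_lt[]|/edges_lt[]|/andP[/eqP-> _]] //.
Qed.

Lemma rho_edge k (x y : 'I_n) :
  ((x : nat, y : nat) \in edges n k) || ((y : nat, x : nat) \in edges n k) -> rho n k x = y.
Proof.
by apply: prod_transp_edge; [exact: edges_matching | exact: edges_uniq | exact: edges_lt].
Qed.

Lemma rho_cases k (x : 'I_n) : k < 4 ->
  (rho n k x : nat) = edge_actn k x /\ rho n k (rho n k x) = x.
Proof.
move=> k4; have kx := edge_actn_lt k4 (ltn_ord x).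
have := edge_actn_edge k4 (ltn_ord x); rewrite orbA; case/orP=> [kxE|/andP[/eqP-> /allP fx]].
  by rewrite (rho_edge (y := Ordinal kx) kxE); split=> //; apply: rho_edge; rewrite orbC.
suff rx : rho n k x = x by rewrite !rx.
apply: prod_transp_fix => e ke.
by have [? ?] := edges_lt ke; have /andP[] := fx e ke.
Qed.

Lemma rhoE k (x : 'I_n) : k < 4 -> (rho n k x : nat) = edge_actn k x.
Proof. by case/(rho_cases x). Qed.

Lemma rho_sq k : k < 4 -> rho n k ^+ 2 = 1.
Proof. by move=> k4; apply/permP=> x; rewrite expgS expg1 permM perm1; case: (rho_cases x k4). Qed.

End Graph.

(** * Parabolic subgroups *)

Definition word_act (w : seq nat) (x : nat) : nat := foldl (fun y k => edge_act k y) x w.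

Definition wordp (n : nat) (w : seq nat) : {perm 'I_n} := \prod_(k <- w) rho n k.

(* Words in rho_0, rho_1, rho_2 act in the same way on all the pairs {12,13},
   {14,15}, .., so that they can be compared on the vertices below 14. *)
Definition periodic (f : nat -> nat) := forall x, 11 < x -> f x.+2 = (f x).+2.

Lemma eq_periodic (f g : nat -> nat) : periodic f -> periodic g ->
  all (fun x => f x == g x) (iota 0 14) -> f =1 g.
Proof.
move=> pf pg fg x; have [m] := ubnP x; elim/ltn_ind: m x => m IHm x xm.
have [x14|x14] := ltnP x 14; first by apply/eqP/(allP fg); rewrite mem_iota.
have -> : x = (x - 2).+2 by lia.
by rewrite pf ?pg; [rewrite (IHm x) //; lia | lia..].
Qed.

(** Labels 0, 1, 2 preserve the numbers above 11 and commute there with the shift by 2. Label 3 is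
    left out because it sends 12 to 11. *)
Lemma word_act_periodic w : all (fun k => k < 3) w -> periodic (word_act w).
Proof.
elim: w => [|k w IHw] //= /andP[k3 w3] x x12.
change (word_act w (edge_act k x.+2) = (word_act w (edge_act k x)).+2).
have [kx12 kE] : 11 < edge_act k x /\ edge_act k x.+2 = (edge_act k x).+2.
  rewrite !edge_act_ge; try lia; case: k k3 => [|[|[|]]] //= _.
  by rewrite negbK; case: ifP; have [->|] := eqVneq x 12; rewrite //; lia.
by rewrite kE; exact: (IHw w3 _ kx12).
Qed.

(** A test independent of n: one computation settles an identity between words for every n. *)
Definition eqw (v w : seq nat) : bool :=
  [&& all (fun k => k < 3) v, all (fun k => k < 3) w
    & all (fun x => word_act v x == word_act w x) (iota 0 14)].

Section GenSub.

Context (n : nat) (hn : 16 <= n) (n_even : ~~ odd n).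

Lemma wordpE w (x : 'I_n) : all (fun k => k < 3) w -> (wordp n w x : nat) = word_act w x.
Proof.
elim: w x => [|k w IHw] x /=; first by rewrite /wordp big_nil perm1.
case/andP=> k3 w3; rewrite /wordp big_cons permM IHw //.
by rewrite rhoE //; [rewrite /edge_actn ifN //; lia | lia].
Qed.

Lemma wordp_eq v w : eqw v w -> wordp n v = wordp n w.
Proof.
case/and3P=> v3 w3 vw; apply/permP=> x; apply: ord_inj; rewrite !wordpE //.
exact: eq_periodic (word_act_periodic v3) (word_act_periodic w3) vw x.
Qed.

Lemma rho_commute i j : i < 4 -> j < 4 -> i.+1 < j -> commute (rho n i) (rho n j).
Proof.
move=> i4 j4 ij; case: (eqVneq j 3) => [j3|].
  rewrite j3; have i2 : i < 2 by lia.
  apply/permP=> x; apply: ord_inj; rewrite !permM !rhoE //.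
  have fix12 y : 11 < y -> edge_actn n i y = y.
    by move=> y12; rewrite /edge_actn edge_act_ge //; case: i i2 {i4 ij} => [|[|]].
  have [x12|x12] := ltnP x 12.
    have actE k y : y < 13 -> edge_actn n k y = edge_act k y.
      by move=> y13; rewrite /edge_actn; case: eqP => //= _; case: eqP => //; lia.
    suff /and4P[H1 H2 H3 /eqP]: [&& x < 13, edge_act i x < 13, edge_act 3 x < 13
        & edge_act 3 (edge_act i x) == edge_act i (edge_act 3 x)].
      by rewrite !actE.
    by move: (x : nat) x12 i i2 {i4 ij fix12 actE}; do 12 (case=> [_ [|[|]]|] //).
  have x11 : 11 < edge_actn n 3 x \/ edge_actn n 3 x = 11.
    rewrite /edge_actn /=; case: eqP; first by lia.
    by rewrite edge_act_ge //; case: ifP; lia.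
  rewrite (fix12 x) //; case: x11 => [/fix12->//|->].
  by rewrite /edge_actn; case: i i2 {i4 ij fix12} => [|[|]].
move=> j3; have [-> ->] : i = 0%N /\ j = 2 by lia.
have := @wordp_eq [:: 0; 2]%N [:: 2; 0]%N; rewrite /wordp !big_cons !big_nil !mulg1; exact.
Qed.

(** Coset enumeration: H * T contains 1 and absorbs each generator on the right, hence every word in
    A. *)
Lemma gen_transversal (gT : finGroupType) (H : {group gT}) (A T : {set gT}) :
    1 \in T -> (forall t s, t \in T -> s \in A -> t * s \in H * T) ->
  <<A>> \subset H * T.
Proof.
move=> T1 TA; apply/subsetP=> g /gen_prodgP[m [c Ac ->]].
elim: m c Ac => [|m IHm] c Ac; first by rewrite big_ord0 -[1]mulg1 mem_mulg.
rewrite big_ord_recr /=.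
have /mulsgP[h t Hh Tt ->] := IHm (fun i => c (widen_ord (leqnSn m) i)) (fun i => Ac _).
have /mulsgP[h' t' Hh' Tt' eht] := TA t _ Tt (Ac ord_max).
by rewrite -mulgA eht mulgA mem_mulg ?groupM.
Qed.

Lemma gen_sub_transversal (J K : {set 'I_4}) (hs ws : seq (seq nat)) g :
    [::] \in ws ->
    (forall h, h \in hs -> all (fun k => k \in [seq val i | i in K]) h) ->
    (forall w j, w \in ws -> j \in J ->
       has (fun h => has (fun v => eqw (rcons w j) (h ++ v)) ws) hs) ->
    g \in gen_sub (rho n) J ->
  exists h w, [/\ h \in gen_sub (rho n) K, w \in ws & g = h * wordp n w].
Proof.
move=> ws0 hsK wsJ Jg.
have hK h : h \in hs -> wordp n h \in gen_sub (rho n) K.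
  move/hsK/allP=> hP; rewrite /wordp big_seq; apply: group_prod => k /hP /imageP[i Ki ->].
  exact: gen_sub_mem.
have /subsetP/(_ g Jg) :
    gen_sub (rho n) J \subset gen_sub (rho n) K * [set t in map (wordp n) ws].
  apply: gen_transversal.
    by rewrite inE; apply/mapP; exists [::] => //; rewrite /wordp big_nil.
  move=> t s; rewrite inE => /mapP[w ww ->] /imsetP[j Jj ->].
  have /hasP[h hh /hasP[v vv /wordp_eq]] := wsJ w j ww Jj.
  rewrite /wordp -cats1 !big_cat big_seq1 /= => ->.
  by rewrite mem_mulg ?hK // inE map_f.
by case/mulsgP=> h t Kh; rewrite inE => /mapP[w ww ->] ->; exists h, w.
Qed.

(** S stays below 12, away from n-1, so that [edge_act] also describes rho_3 on it. *)
Lemma gen_sub_stable (J : {set 'I_4}) (S : seq nat) (u : {perm 'I_n}) :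
    all (fun x => x < 12) S ->
    (forall j, j \in J -> all (fun x => edge_act j x \in S) S) ->
    u \in gen_sub (rho n) J -> forall x : 'I_n, (x : nat) \in S -> (u x : nat) \in S.
Proof.
move=> S12 JS /gen_prodgP[m [c Jc ->]]; elim: m c Jc => [|m IHm] c Jc x Sx.
  by rewrite big_ord0 perm1.
rewrite big_ord_recr permM /=.
have := IHm (fun i => c (widen_ord (leqnSn m) i)) (fun i => Jc _) x Sx.
move: (_ x) => y Sy; have /imsetP[j Jj ->] := Jc ord_max.
rewrite rhoE ?ltn_ord // /edge_actn ifN; last by have := allP S12 _ Sy; lia.
exact: (allP (JS j Jj)).
Qed.

(* ws: right coset representatives of <rho_k : a < k < b> in <rho_k : a <= k < b>;
   hs: the words in the rho_k, a < k < b, that are needed to see that these cosets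
   are permuted; SS: sets of vertices preserved by rho_k for a < k <= b but not
   all by any nonempty word of ws. *)
Definition cap_check (a b : nat) (hs ws SS : seq (seq nat)) : bool :=
  [&& [::] \in ws,
      all (all (fun k => a < k < b)) hs,
      all (fun w => all (fun j => has (fun h => has (fun v => eqw (rcons w j) (h ++ v)) ws) hs)
        (iota a (b - a))) ws,
      all (all (fun x => x < 12)) SS,
      all (fun S => all (fun j => all (fun x => edge_act j x \in S) S) (iota a.+1 (b - a))) SS
    & all (fun w => all (fun k => k < 3) w &&
        ((w == [::]) || has (fun S => has (fun x => word_act w x \notin S) S) SS)) ws].

(** An element of the intersection is h w, with h in the small subgroup and w a representative. Then
    w also lies in the second group, so it preserves every set of SS, which by the check forces w to
    be empty. *)
Lemma gen_sub_cap_range a b (hs ws SS : seq (seq nat)) : b < 4 -> cap_check a b hs ws SS ->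
  gen_sub (rho n) (index_range 4 a b) :&: gen_sub (rho n) (index_range 4 a.+1 b.+1)
    \subset gen_sub (rho n) (index_range 4 a.+1 b).
Proof.
move=> b4.
have sKL : index_range 4 a.+1 b \subset index_range 4 a.+1 b.+1.
  by apply/subsetP=> k; rewrite !inE; lia.
have abJ k : a <= k < b -> k \in iota a (b - a) by rewrite mem_iota; lia.
have abL k : a < k < b.+1 -> k \in iota a.+1 (b - a) by rewrite mem_iota; lia.
have abK k : a < k < b -> k < 4 by lia.
case/and5P=> ws0 hsab wsab SS12 /andP[SSab wsSS]; apply/subsetP=> g /setIP[Jg Lg].
have [||h [w [Kh ww eg]]] :=
  @gen_sub_transversal (index_range 4 a b) (index_range 4 a.+1 b) hs ws g ws0 _ _ Jg.
- move=> h /(allP hsab)/allP hP; apply/allP=> k /hP akb; apply/imageP.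
  by exists (Ordinal (abK k akb)); rewrite ?inE.
- by move=> w j /(allP wsab)/allP wP; rewrite inE => /abJ; apply: wP.
have Lw : wordp n w \in gen_sub (rho n) (index_range 4 a.+1 b.+1).
  by rewrite -(groupMl _ (subsetP (gen_subS _ sKL) _ Kh)) -eg.
have /andP[w3 /predU1P[w_nil|/hasP[S SSS /hasP[x Sx]]]] := allP wsSS w ww.
  by rewrite eg w_nil /wordp big_nil mulg1.
have S12 := allP SS12 S SSS.
have xn : x < n := leq_trans (allP S12 x Sx) (leq_trans (isT : 12 <= 16) hn).
have SL (j : 'I_4) : j \in index_range 4 a.+1 b.+1 -> all (fun x => edge_act j x \in S) S.
  by rewrite inE => /abL; apply: (allP (allP SSab S SSS)).
by have := gen_sub_stable S12 SL Lw (x := Ordinal xn) Sx; rewrite wordpE // => ->.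
Qed.

Lemma rho_intersection_property : intersection_property 4 (rho n).
Proof.
apply: intersection_property_interval => [|a b /andP[ab b4]]; first exact: rho_commute.
have : [|| (a, b) == (0, 1), (a, b) == (1, 2), (a, b) == (2, 3),
           (a, b) == (0, 2), (a, b) == (1, 3) | (a, b) == (0, 3)]%N by rewrite !xpair_eqE; lia.
(* In all cases the representatives are the prefixes of one word. In the first three the group is
   generated by rho_a alone, which moves the vertex a, while rho_(a+1) fixes it. *)
pose pre (w : seq nat) := [seq take k w | k <- iota 0 (size w).+1].
move/predU1P=> [[-> ->]|].
  by apply: (@gen_sub_cap_range _ _ [:: [::]] (pre [:: 0%N]) [:: [:: 0%N]]); vm_compute.
move/predU1P=> [[-> ->]|].
  by apply: (@gen_sub_cap_range _ _ [:: [::]] (pre [:: 1%N]) [:: [:: 1%N]]); vm_compute.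
move/predU1P=> [[-> ->]|].
  by apply: (@gen_sub_cap_range _ _ [:: [::]] (pre [:: 2%N]) [:: [:: 2%N]]); vm_compute.
move/predU1P=> [[-> ->]|].
  by apply: (@gen_sub_cap_range _ _ (pre [:: 1%N]) (pre [:: 0; 1]%N) [:: [:: 0%N]]); vm_compute.
(* There are 12 cosets, but the orbit of 1 under rho_1 and rho_2 is only {1, 2, 3, 8}; the
   nontrivial representatives fixing 1 are caught by {5, .., 10}. *)
move/predU1P=> [[-> ->]|/eqP[-> ->]].
  by apply: (@gen_sub_cap_range _ _ (pre [:: 2%N]) (pre [:: 1; 2; 1; 2; 1; 2; 1; 2; 1; 2; 1]%N)
            [:: [:: 1]; [:: 5; 6; 7; 8; 9; 10]]%N); vm_compute.
(* The six representatives send 0 to 0, 1, 2, 3, 8, 5. The long word of [hs] is the correction when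
   rho_2 is multiplied to 0121 or to 01210. *)
by apply: (@gen_sub_cap_range _ _ [:: [::]; [:: 1]; [:: 2]; [:: 2; 1; 2; 1; 2; 1; 2; 1; 2]]%N
            (pre [:: 0; 1; 2; 1; 0]%N) [:: [:: 0%N]]); vm_compute.
Qed.

Lemma rho_string_C_group : string_C_group (Ggen n) 4 (rho n).
Proof.
split; last exact: rho_intersection_property.
split=> // [i i4|i j i4 j4 ij].
  split; first exact: rho_sq.
  have n0 : 0 < n by lia. have n1 : 1 < n by lia. have n2 : 2 < n by lia. have n3 : 3 < n by lia.
  have neq (x : 'I_n) : edge_actn n i x != x -> rho n i != 1.
    by apply: contraNneq => r1; rewrite -rhoE // r1 perm1.
  case: i i4 neq => [|[|[|[|]]]] // i4 neq.
  - by apply: (neq (Ordinal n0)).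
  - by apply: (neq (Ordinal n1)).
  - by apply: (neq (Ordinal n2)).
  - by apply: (neq (Ordinal n3)); rewrite /edge_actn ifN //=; lia.
have cij : commute (rho n i) (rho n j).
  by case/orP: ij => ij; [|apply: commute_sym]; apply: rho_commute.
by rewrite expgMn // !rho_sq // mulg1.
Qed.

End GenSub.

(** * The alternating group *)

(** For distinct a, x, y, (x y) = (a x)(a y)(a x). *)
Lemma star_tpermP (T : finType) (a : T) (s : {perm T}) :
  exists2 cs : seq T, a \notin cs & s = \prod_(c <- cs) tperm a c.
Proof.
have [ts -> _] := prod_tpermP s; elim: ts => [|[x y] ts [cs acs IHts]].
  by exists [::] => //; rewrite !big_nil.
suff [us aus xyE] : exists2 us : seq T, a \notin us & tperm x y = \prod_(c <- us) tperm a c.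
  by exists (us ++ cs); rewrite ?mem_cat ?negb_or ?aus // big_cons big_cat xyE -IHts.
have [->|nxy] := eqVneq x y; first by exists [::]; rewrite // tperm1 big_nil.
have [xa|nxa] := eqVneq a x; first by exists [:: y]; rewrite ?inE ?xa // big_seq1.
have [ya|nya] := eqVneq a y; first by exists [:: x]; rewrite ?inE // big_seq1 -ya tpermC.
exists [:: x; y; x]; first by rewrite !inE !negb_or nxa nya.
rewrite !big_cons big_nil mulg1 mulgA -{1}(tpermV a x).
by rewrite -mulgA -conjgE tpermJ tpermL tpermD // eq_sym.
Qed.

(** An even permutation is a product of pairs (a c)(a d), and each pair is the inverse of (a b)(a c)
    times (a b)(a d). *)
Lemma Alt_sub_3cycles (T : finType) (a b : T) (G : {group {perm T}}) : a != b ->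
    (forall c, c != a -> c != b -> tperm a b * tperm a c \in G) ->
  'Alt_T \subset G.
Proof.
move=> nab G3; have Gb c : c != a -> tperm a b * tperm a c \in G.
  by have [->|cb ca] := eqVneq c b; [rewrite tperm2 group1 | exact: G3].
have G2 c d : c != a -> d != a -> tperm a c * tperm a d \in G.
  move=> ca da; rewrite -(mulKg (tperm a b) (tperm a d)) tpermV mulgA.
  by rewrite groupM ?Gb // -groupV invMg !tpermV Gb.
apply/subsetP=> s; have [cs acs ->] := star_tpermP a s; rewrite Alt_even.
have [m] := ubnP (size cs); elim: m cs acs => // m IHm [|c [|d cs]] /=.
- by rewrite big_nil group1.
- by rewrite inE big_seq1 odd_tperm => ->.
rewrite !inE !negb_or => /and3P[ac ad acs] cs_m; rewrite !big_cons !odd_mul_tperm ac ad negbK => ev.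
by rewrite mulgA groupM ?G2 1?eq_sym // IHm //; lia.
Qed.

(** * Explicit 3-cycles in the group *)

Definition swaps (s : seq (nat * nat)) (x : nat) : nat := foldl (fun y e => swap e.1 e.2 y) x s.

(** The transpositions need not be disjoint: [[:: (a, b); (a, c)]] is the 3-cycle sending a to b, b
    to c and c to a. *)
Definition swapp (n : nat) (s : seq (nat * nat)) : {perm 'I_n} := \prod_(e <- s) transp n e.

(** Such products fix all vertices from 12 on, and their entries avoid n-1, so identities and
    conjugates are computed uniformly in n. *)
Definition small (s : seq (nat * nat)) : bool := all (fun e => (e.1 < 12) && (e.2 < 12)) s.

Lemma swaps_periodic s : small s -> periodic (swaps s).
Proof.
have fixs x : 11 < x -> small s -> swaps s x = x.
  move=> x12; elim: s => [|[a b] s IHs] //= /andP[/andP[/= a12 b12] /IHs].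
  by rewrite /swaps /= /swap !ifN //; lia.
by move=> s12 x x12; rewrite !fixs //; lia.
Qed.

Section Alternating.

Context (n : nat) (hn : 16 <= n) (n_even : ~~ odd n).

Lemma swappE s (x : 'I_n) : (forall e, e \in s -> e.1 < n /\ e.2 < n) ->
  (swapp n s x : nat) = swaps s x.
Proof.
elim: s x => [|[a b] s IHs] x sn; first by rewrite /swapp big_nil perm1.
have [/= an bn] := sn (a, b) (mem_head _ _).
rewrite /swapp big_cons permM IHs /= ?transpE // => e se.
by apply: sn; rewrite inE se orbT.
Qed.

Lemma small_ltn s : small s -> forall e, e \in s -> e.1 < n /\ e.2 < n.
Proof.
move=> /allP s12 e /s12/andP[e1 e2].
by split; [apply: leq_trans e1 _ | apply: leq_trans e2 _]; lia.
Qed.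

Lemma swapp_small s (x : 'I_n) : small s -> (swapp n s x : nat) = swaps s x.
Proof. by move=> s12; apply: swappE; exact: small_ltn. Qed.

Lemma swapp_eq s u : small s -> small u ->
  all (fun x => swaps s x == swaps u x) (iota 0 14) -> swapp n s = swapp n u.
Proof.
move=> s12 u12 su; apply/permP=> x; apply: ord_inj; rewrite !swapp_small //.
exact: eq_periodic (swaps_periodic s12) (swaps_periodic u12) su x.
Qed.

Lemma wordp_swapp w s : all (fun k => k < 3) w -> small s ->
  all (fun x => word_act w x == swaps s x) (iota 0 14) -> wordp n w = swapp n s.
Proof.
move=> w3 s12 ws; apply/permP=> x; apply: ord_inj; rewrite swapp_small // wordpE //.
exact: eq_periodic (word_act_periodic w3) (swaps_periodic s12) ws x.
Qed.

Lemma transpJ k a b : k < 4 -> a < n -> b < n ->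
  transp n (a, b) ^ rho n k = transp n (edge_actn n k a, edge_actn n k b).
Proof.
move=> k4 an bn; rewrite /transp /= !insubT ?edge_actn_lt // => ka kb.
by rewrite tpermJ; congr tperm; apply: ord_inj; rewrite rhoE.
Qed.

Lemma swappJ k s : k < 4 -> (forall e, e \in s -> e.1 < n /\ e.2 < n) ->
  swapp n s ^ rho n k = swapp n [seq (edge_actn n k e.1, edge_actn n k e.2) | e <- s].
Proof.
move=> k4; elim: s => [|[a b] s IHs] sn; first by rewrite /swapp !big_nil conj1g.
have [/= an bn] := sn (a, b) (mem_head _ _).
rewrite /swapp !big_cons conjMg transpJ // -/(swapp n s) IHs // => e se.
by apply: sn; rewrite inE se orbT.
Qed.

Lemma rho_in_Ggen k : k < 4 -> rho n k \in Ggen n.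
Proof. by move=> k4; apply: (@gen_sub_mem _ _ (rho n) setT (Ordinal k4)); rewrite inE. Qed.

Lemma swapp_conj k s : k < 4 -> (forall e, e \in s -> e.1 < n /\ e.2 < n) -> swapp n s \in Ggen n ->
  swapp n [seq (edge_actn n k e.1, edge_actn n k e.2) | e <- s] \in Ggen n.
Proof. by move=> k4 sn Gs; rewrite -swappJ // groupJ ?rho_in_Ggen. Qed.

Lemma edge_actn_small k x : x < 12 -> edge_actn n k x = edge_act k x.
Proof. by move=> x12; rewrite /edge_actn ifN //; lia. Qed.

Lemma swapp_conj_small k s u : swapp n s \in Ggen n ->
    [&& k < 4, small s & u == [seq (edge_act k e.1, edge_act k e.2) | e <- s]] ->
  swapp n u \in Ggen n.
Proof.
move=> Gs /and3P[k4 s12 /eqP->].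
suff -> : [seq (edge_act k e.1, edge_act k e.2) | e <- s]
        = [seq (edge_actn n k e.1, edge_actn n k e.2) | e <- s].
  exact: swapp_conj k4 (small_ltn s12) Gs.
by apply/eq_in_map=> e /(allP s12)/andP[e1 e2]; rewrite !edge_actn_small.
Qed.

Lemma swapp_mul s t u : swapp n s \in Ggen n -> swapp n t \in Ggen n ->
    small (s ++ t) && small u -> all (fun x => swaps (s ++ t) x == swaps u x) (iota 0 14) ->
  swapp n u \in Ggen n.
Proof.
move=> Gs Gt /andP[st12 u12] stu; rewrite -(swapp_eq st12 u12 stu).
by rewrite /swapp big_cat groupM.
Qed.

(** Apart from 0 and 1, the vertices form two orbits under rho_2 and rho_3, the long path and {5,
    .., 10}; 2 and 10 represent them. *)
Lemma cycle3_seed :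
  swapp n [:: (0, 1); (0, 2)]%N \in Ggen n /\ swapp n [:: (0, 1); (0, 10)]%N \in Ggen n.
Proof.
have G18_23 : swapp n [:: (1, 8); (2, 3)]%N \in Ggen n.
  have <- : wordp n (flatten (nseq 6 [:: 1; 2]%N)) = swapp n [:: (1, 8); (2, 3)]%N.
    by apply: wordp_swapp; vm_compute.
  rewrite /wordp big_seq; apply: group_prod => k k12; apply: rho_in_Ggen.
  by move: k k12; apply/allP.
have G05_23 : swapp n [:: (0, 5); (2, 3)]%N \in Ggen n.
  by apply: (swapp_conj_small (k := 0%N) G18_23).
have G19_24 : swapp n [:: (1, 9); (2, 4)]%N \in Ggen n.
  by apply: (swapp_conj_small (k := 3) G18_23).
pose d := [:: (0, 5); (2, 3); (1, 9); (2, 4)]%N.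
have Gd : swapp n d \in Ggen n.
  by apply: (swapp_mul G05_23 G19_24); vm_compute.
(* d is (0 5)(1 9) times the 3-cycle (2 3 4); squaring removes the transpositions, and squaring
   again inverts the 3-cycle. *)
have G243 : swapp n [:: (2, 4); (2, 3)]%N \in Ggen n.
  by apply: (swapp_mul Gd Gd); vm_compute.
have G234 : swapp n [:: (2, 3); (2, 4)]%N \in Ggen n.
  by apply: (swapp_mul G243 G243); vm_compute.
(* Conjugation by single generators carries (2 3 4) to (10 1 2) and then to (10 0 1); their product
   in the order (10 1 2), (0 1 10) is (0 1 2). *)
have G3_2_11 : swapp n [:: (3, 2); (3, 11)]%N \in Ggen n.
  by apply: (swapp_conj_small (k := 2) G234).
have G8_1_11 : swapp n [:: (8, 1); (8, 11)]%N \in Ggen n.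
  by apply: (swapp_conj_small (k := 1%N) G3_2_11).
have G8_1_4 : swapp n [:: (8, 1); (8, 4)]%N \in Ggen n.
  by apply: (swapp_conj_small (k := 2) G8_1_11).
have G9_1_3 : swapp n [:: (9, 1); (9, 3)]%N \in Ggen n.
  by apply: (swapp_conj_small (k := 3) G8_1_4).
have G10_1_2 : swapp n [:: (10, 1); (10, 2)]%N \in Ggen n.
  by apply: (swapp_conj_small (k := 2) G9_1_3).
have G7_0_2 : swapp n [:: (7, 0); (7, 2)]%N \in Ggen n.
  by apply: (swapp_conj_small (k := 0%N) G10_1_2).
have G10_0_1 : swapp n [:: (10, 0); (10, 1)]%N \in Ggen n.
  by apply: (swapp_conj_small (k := 1%N) G7_0_2).
have G0_1_10 : swapp n [:: (0, 1); (0, 10)]%N \in Ggen n.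
  have -> // : swapp n [:: (0, 1); (0, 10)]%N = swapp n [:: (10, 0); (10, 1)]%N.
  by apply: swapp_eq; vm_compute.
by split=> //; apply: (swapp_mul G10_1_2 G0_1_10).
Qed.

Lemma cycle3_conj m k u : swapp n [:: (0, 1); (0, m)]%N \in Ggen n -> m < n ->
  1 < k < 4 -> edge_actn n k m = u -> swapp n [:: (0, 1); (0, u)]%N \in Ggen n.
Proof.
move=> Gm mn k4 <-; have k4' : k < 4 by lia.
have fix01 x : x < 2 -> edge_actn n k x = x.
  move=> x2; rewrite /edge_actn ifN; last by lia.
  by case: x x2 => [|[|]] // _; case: k k4 {k4'} => [|[|[|[|]]]].
have lt_n e : e \in [:: (0, 1); (0, m)]%N -> e.1 < n /\ e.2 < n.
  by rewrite !inE => /orP[] /eqP->; split; rewrite /=; lia.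
by have := swapp_conj k4' lt_n Gm; rewrite /= (fix01 0%N) ?(fix01 1%N).
Qed.

(** The edge from q + 11 to the next vertex is labelled 3 or 2 according as q + 11 is odd or even.
    The vertex 11 is separate, being in the table. *)
Lemma cycle3_tail q : swapp n [:: (0, 1); (0, 11)]%N \in Ggen n ->
  q + 11 < n -> swapp n [:: (0, 1); (0, q + 11)]%N \in Ggen n.
Proof.
move=> G11; elim: q => [|q IHq] qn //; move/(_ (ltnW qn)): IHq => Gq.
have nq : (q + 11 == n.-1) = false by lia.
have [q0|q12] := eqVneq q 0%N.
  by apply: (cycle3_conj (k := 3) Gq _ _ _); rewrite ?(ltnW qn) // q0 /edge_actn ifN //; lia.
have v12 : 11 < q + 11 by lia.
case oq: (odd (q + 11)).
  apply: (cycle3_conj (k := 3) Gq); rewrite ?(ltnW qn) //.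
  by rewrite /edge_actn nq edge_act_ge // oq.
apply: (cycle3_conj (k := 2) Gq); rewrite ?(ltnW qn) //.
by rewrite /edge_actn edge_act_ge // oq.
Qed.

Lemma cycle3_Ggen m : 1 < m < n -> swapp n [:: (0, 1); (0, m)]%N \in Ggen n.
Proof.
have [G2 G10] := cycle3_seed.
have step k p q : swapp n [:: (0, 1); (0, p)]%N \in Ggen n ->
    [&& p < 12, 1 < k < 4 & edge_act k p == q] -> swapp n [:: (0, 1); (0, q)]%N \in Ggen n.
  move=> Gp /and3P[p12 k4 /eqP pq]; apply: (cycle3_conj Gp _ k4); first by lia.
  by rewrite edge_actn_small.
have G3 : swapp n [:: (0, 1); (0, 3)]%N \in Ggen n by apply: (step 2 _ _ G2).
have G4 : swapp n [:: (0, 1); (0, 4)]%N \in Ggen n by apply: (step 3 _ _ G3).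
have G11 : swapp n [:: (0, 1); (0, 11)]%N \in Ggen n by apply: (step 2 _ _ G4).
have G9 : swapp n [:: (0, 1); (0, 9)]%N \in Ggen n by apply: (step 2 _ _ G10).
have G8 : swapp n [:: (0, 1); (0, 8)]%N \in Ggen n by apply: (step 3 _ _ G9).
have G7 : swapp n [:: (0, 1); (0, 7)]%N \in Ggen n by apply: (step 3 _ _ G10).
have G6 : swapp n [:: (0, 1); (0, 6)]%N \in Ggen n by apply: (step 2 _ _ G7).
have G5 : swapp n [:: (0, 1); (0, 5)]%N \in Ggen n by apply: (step 3 _ _ G6).
case/andP=> m1 mn; have [m11|m11] := leqP 11 m.
  by rewrite -(subnK m11); apply: cycle3_tail; rewrite ?subnK.
by move: m m11 m1 {mn}; do 11 (case=> [|] //).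
Qed.

Lemma transp_ord (x y : 'I_n) : transp n (x : nat, y : nat) = tperm x y.
Proof. by rewrite /transp /= !valK. Qed.

Lemma Alt_sub_Ggen : 'Alt_('I_n) \subset Ggen n.
Proof.
have n0 : 0 < n by lia. have n1 : 1 < n by lia.
apply: (@Alt_sub_3cycles _ (Ordinal n0) (Ordinal n1)) => // c c0 c1.
have c2 : 1 < c < n by rewrite ltn_ord; move: c0 c1; rewrite -!(inj_eq (@ord_inj n)) /=; lia.
have := cycle3_Ggen c2; rewrite /swapp !big_cons big_nil mulg1.
by rewrite (transp_ord (Ordinal n0) (Ordinal n1)) (transp_ord (Ordinal n0) c).
Qed.

(** * Parity of the generators *)

Lemma odd_prod_transp s : (forall e, e \in s -> [/\ e.1 < n, e.2 < n & e.1 != e.2]) ->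
  odd_perm (\prod_(e <- s) transp n e) = odd (size s).
Proof.
elim: s => [|[a b] s IHs] sP; first by rewrite big_nil odd_perm1.
have [/= an bn ab] := sP (a, b) (mem_head _ _).
rewrite big_cons odd_permM /= IHs => [|e se]; last by apply: sP; rewrite inE se orbT.
by rewrite /transp /= !insubT odd_tperm -(inj_eq (@ord_inj n)) /= ab.
Qed.

(** The f-path has n - 12 edges, a multiple of 4, with alternating labels. *)
Lemma size_f_edges p : n %% 4 = 0 -> ~~ odd (size (f_edges n p)).
Proof.
move=> n4; rewrite size_map size_filter.
have -> : (n - 11 - 1 = 4 * (n %/ 4 - 3))%N by lia.
elim: (n %/ 4 - 3)%N => [|q IHq] //; rewrite mulnSr iotaD count_cat oddD (negPf IHq).
by rewrite /= oddM /=; case: p {IHq}.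
Qed.

Lemma Ggen_sub_Alt : n %% 4 = 0 -> Ggen n \subset 'Alt_('I_n).
Proof.
move=> n4; apply: gen_sub_min => j _; rewrite Alt_even /rho odd_prod_transp.
  by case: j => -[|[|[|[|]]]] //= _; rewrite ?negbK size_f_edges.
move=> e je; have [e1 e2] : e.1 < n /\ e.2 < n by apply: edges_lt je.
by split=> //; apply: edges_neq je.
Qed.

End Alternating.

(** * Orders of the products *)

Section Orders.

Context (n : nat) (hn : 16 <= n) (n_even : ~~ odd n).

Lemma wordpX w k : wordp n w ^+ k = wordp n (flatten (nseq k w)).
Proof.
elim: k => [|k IHk]; first by rewrite /wordp big_nil.
by rewrite expgS IHk /wordp big_cat.
Qed.

Lemma wordp_neq1 w (x : nat) : all (fun k => k < 3) w -> x < n -> word_act w x != x ->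
  wordp n w != 1.
Proof.
move=> w3 xn; apply: contraNneq => w1.
by have := wordpE hn n_even (Ordinal xn) w3; rewrite w1 perm1 => <-.
Qed.

Lemma order_rho01 : #[rho n 0 * rho n 1] = 3.
Proof.
have -> : rho n 0 * rho n 1 = wordp n [:: 0; 1]%N by rewrite /wordp !big_cons big_nil mulg1.
apply: nt_prime_order => //.
  by rewrite wordpX (@wordp_eq _ hn n_even _ [::]) // /wordp big_nil.
by apply: (@wordp_neq1 _ 0) => //; lia.
Qed.

(** The product has the 6-cycle (4 10 6 7 9 11) and the 4-cycle (1 3 8 2), hence the witnesses 4 and
    1; a divisor of 12 dividing neither 4 nor 6 is 12. *)
Lemma order_rho12 : #[rho n 1 * rho n 2] = 12.
Proof.
have -> : rho n 1 * rho n 2 = wordp n [:: 1; 2]%N by rewrite /wordp !big_cons big_nil mulg1.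
have d12 : #[wordp n [:: 1; 2]%N] %| 12.
  by rewrite order_dvdn wordpX (@wordp_eq _ hn n_even _ [::]) // /wordp big_nil.
have nd4 : ~~ (#[wordp n [:: 1; 2]%N] %| 4).
  by rewrite order_dvdn wordpX; apply: (@wordp_neq1 _ 4) => //; lia.
have nd6 : ~~ (#[wordp n [:: 1; 2]%N] %| 6).
  by rewrite order_dvdn wordpX; apply: (@wordp_neq1 _ 1) => //; lia.
move: nd4 nd6; move: d12; rewrite dvdn_divisors // => /=.
by rewrite !inE => /or4P[/eqP->|/eqP->|/eqP->|/or3P[/eqP->|/eqP->|/eqP->]].
Qed.

End Orders.

Lemma perm_cycle_iter n (x : {perm 'I_n}) (m : nat) (g : nat -> nat) : 0 < m ->
    (forall j (y : 'I_n), j < m -> (y : nat) = g j -> (x y : nat) = g (j.+1 %% m)) ->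
  forall k j (y : 'I_n), j < m -> (y : nat) = g j -> ((x ^+ k) y : nat) = g ((j + k) %% m).
Proof.
move=> m0 xg; elim=> [|k IHk] j y jm yj; first by rewrite perm1 addn0 modn_small.
by rewrite expgS permM (IHk (j.+1 %% m)) ?ltn_pmod ?(xg j) // modnDml addnS addSn.
Qed.

(** * The cycles of rho_2 rho_3 *)

Section PathOrder.

Context (n : nat) (hn : 16 <= n) (n_even : ~~ odd n).

(* The path 2, 3, 4, 11, 12, .., n-1, and the order in which rho_2 rho_3 runs
   through its positions: up the even ones, then down the odd ones. *)
Definition path_vertex (q : nat) : nat := if q < 3 then q.+2 else q + 8.

Definition path_pos (m j : nat) : nat := if j.*2 < m then j.*2 else (m - j).*2.-1.

(** The short path 8, 9, 10, 7, 6, 5, in the order of the cycle of rho_2 rho_3 on it. *)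
Definition hexagon (j : nat) : nat := nth 0 [:: 6; 10; 8; 9; 7; 5] j.

Lemma path_vertex_ge q : 2 < q -> path_vertex q = q + 8.
Proof. by move=> q2; rewrite /path_vertex ifN //; lia. Qed.

Lemma path_edge2 q : edge_actn n 2 (path_vertex q) = path_vertex (if odd q then q.-1 else q.+1).
Proof.
have [q4|q4] := ltnP q 4; first by case: q q4 => [|[|[|[|]]]].
have v12 : 11 < q + 8 by lia.
rewrite /edge_actn andFb (path_vertex_ge (ltnW q4)) edge_act_ge // oddD addbF.
by case: (odd q); rewrite path_vertex_ge; lia.
Qed.

(** At position 0 the truncated [q.-1] is again 0: vertex 2 has no edge labelled 3. The other end, n
    - 9, is odd. *)
Lemma path_edge3 q : q < n - 8 -> edge_actn n 3 (path_vertex q) =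
  path_vertex (if odd q then if q == n - 9 then q else q.+1 else q.-1).
Proof.
move=> qn; have [q4|q4] := ltnP q 4.
  have -> : (q == n - 9) = false by lia.
  rewrite /edge_actn ifN; last by rewrite /path_vertex; case: ifP; lia.
  by case: q q4 {qn} => [|[|[|[|]]]].
have v12 : 11 < q + 8 by lia.
rewrite /edge_actn andTb (path_vertex_ge (ltnW q4)) edge_act_ge // oddD addbF.
have -> : (q + 8 == n.-1) = (q == n - 9) by lia.
case: eqP => [qE|_].
  have -> : odd q by rewrite qE oddB; [rewrite (negPf n_even) | lia].
  by rewrite path_vertex_ge //; lia.
by case: (odd q); rewrite path_vertex_ge; lia.
Qed.

(** From an even position both generators go up by one, except that rho_3 stands still at the end n
    - 9; from an odd one both go down, and rho_3 stands still at 0, which closes the cycle. *)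
Lemma path_step j (y : 'I_n) : j < n - 8 -> (y : nat) = path_vertex (path_pos (n - 8) j) ->
  ((rho n 2 * rho n 3)%g y : nat) = path_vertex (path_pos (n - 8) (j.+1 %% (n - 8))).
Proof.
move=> jm yj; rewrite permM !rhoE // yj path_edge2.
have := odd_double_half n; rewrite (negPf n_even) add0n; set h := n./2 => nE.
have [jm2|jm2] := ltnP j.*2 (n - 8).
  have -> : path_pos (n - 8) j = j.*2 by rewrite /path_pos jm2.
  rewrite odd_double path_edge3; last lia.
  rewrite oddS odd_double modn_small; last lia.
  by congr path_vertex; rewrite /path_pos /=; case: eqP; case: ifP; lia.
have [i iE] : exists i, (n - 8 - j = i.+1)%N by exists (n - 8 - j).-1; lia.
have -> : path_pos (n - 8) j = i.*2.+1 by rewrite /path_pos ifN ?iE //; lia.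
rewrite oddS odd_double path_edge3; last lia.
rewrite odd_double; case: i iE => [|i] iE.
  by have -> : j.+1 = (n - 8)%N by [lia]; rewrite modnn /path_pos ifT //; lia.
rewrite modn_small; last lia.
by congr path_vertex; rewrite /path_pos ifN; lia.
Qed.

Lemma hexagon_step j (y : 'I_n) : j < 6 -> (y : nat) = hexagon j ->
  ((rho n 2 * rho n 3)%g y : nat) = hexagon (j.+1 %% 6).
Proof.
move=> j6 yj; rewrite permM !rhoE // yj {yj}.
have E k x : x < 12 -> edge_actn n k x = edge_act k x by move=> x12; rewrite /edge_actn ifN //; lia.
by move: j j6; do 6 (case=> [_|]; first by rewrite !E).
Qed.

(** The power by the lcm fixes 0, 1 and both cycles pointwise. Conversely, the power by the order
    returns 2 and 6 to themselves, and each enumeration takes its first value only at index 0. *)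
Lemma order_rho23 : #[rho n 2 * rho n 3] = lcmn (n - 8) 6.
Proof.
set x := rho n 2 * rho n 3.
have m0 : 0 < n - 8 by lia.
have path_iter := perm_cycle_iter m0 path_step.
have hex_iter := perm_cycle_iter (isT : 0 < 6) hexagon_step.
have n2 : 2 < n by lia. have n6 : 6 < n by lia.
apply/eqP; rewrite eqn_dvd dvdn_lcm; apply/and3P; split.
- rewrite order_dvdn; apply/eqP/permP=> y; apply: ord_inj; rewrite perm1.
  have mL : (n - 8) %| lcmn (n - 8) 6 by rewrite dvdn_lcml.
  have sL : 6 %| lcmn (n - 8) 6 by rewrite dvdn_lcmr.
  have fix_path q : q < n - 8 -> (y : nat) = path_vertex q -> ((x ^+ lcmn (n - 8) 6) y : nat) = y.
    move=> qm yq.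
    have [j jm qj] : exists2 j, j < n - 8 & q = path_pos (n - 8) j.
      case oq: (odd q).
        exists (n - 8 - q.+1./2)%N; rewrite /path_pos; first by lia.
        by have := odd_double_half q; rewrite oq; try case: ifP; lia.
      by exists q./2; rewrite /path_pos; have := odd_double_half q; rewrite oq; try case: ifP; lia.
    by rewrite (path_iter _ j) -?qj // -modnDmr (eqP mL) addn0 modn_small // -qj.
  have fix_hex j : j < 6 -> (y : nat) = hexagon j -> ((x ^+ lcmn (n - 8) 6) y : nat) = y.
    by move=> j6 yj; rewrite (hex_iter _ j) // -modnDmr (eqP sL) addn0 modn_small.
  have [y12|y11] := ltnP y 11.
    have fix01 : y < 2 -> ((x ^+ lcmn (n - 8) 6) y : nat) = y.
      move=> y2; suff xy : x y = y.
        by congr nat_of_ord; elim: (lcmn _ _) => [|k IHk]; rewrite ?perm1 // expgS permM xy.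
      apply: ord_inj; rewrite permM !rhoE //.
      have fix01 k : 1 < k < 4 -> edge_actn n k y = y.
        rewrite /edge_actn ifN; last by lia.
        by case: (nat_of_ord y) y2 => [|[|]] // _; case: k => [|[|[|[|]]]].
      by rewrite !fix01.
    move: fix01 fix_path fix_hex; case: (nat_of_ord y) y12 => [|[|[|[|[|y']]]]] // y12 f01 fp fh.
    - exact: f01.
    - exact: f01.
    - by apply: (fp 0%N).
    - by apply: (fp 1%N) => //; lia.
    - by apply: (fp 2%N) => //; lia.
    case: y' y12 fh {f01 fp} => [|[|[|[|[|[|]]]]]] // _ fh.
    - exact: (fh 5).
    - exact: (fh 0%N).
    - exact: (fh 4).
    - exact: (fh 2).
    - exact: (fh 3).
    - exact: (fh 1%N).
  apply: (fix_path (y - 8)%N); rewrite /path_vertex; have := ltn_ord y; try case: ifP; lia.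
- have := path_iter #[x] 0%N (Ordinal n2); rewrite expg_order perm1 add0n.
  have p0 : path_vertex (path_pos (n - 8) 0) = 2 by rewrite /path_pos ifT.
  rewrite p0 -[nat_of_ord (Ordinal n2)]/2%N => /(_ m0 erefl)/esym; rewrite /dvdn.
  move: (_ %% (n - 8)) (ltn_pmod #[x] m0) => k km.
  rewrite /path_pos; case: ifP => jm; rewrite /path_vertex; case: ifP; lia.
have := hex_iter #[x] 0%N (Ordinal n6); rewrite expg_order perm1 add0n => /(_ isT erefl) /=.
move: (ltn_pmod #[x] (isT : 0 < 6)); rewrite /dvdn.
by case: (_ %% 6) => [|[|[|[|[|[|]]]]]].
Qed.

End PathOrder.

Local Close Scope group_scope.

Theorem theorem4p4 (n : nat) (hn : 16 <= n) (h4 : n %% 4 = 0) :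
  [/\ (Ggen n \isog 'Alt_('I_n))%g,
      string_C_group (Ggen n) 4 (rho n)
    & schlafli 4 (rho n) = [:: 3; 12; lcmn (n - 8) 6]].
Proof.
have n_even : ~~ odd n by lia.
split; last by rewrite /schlafli /= order_rho01 ?order_rho12 ?order_rho23.
  suff -> : Ggen n = ('Alt_('I_n))%G by exact: isog_refl.
  by apply/val_inj/eqP; rewrite eqEsubset Ggen_sub_Alt ?Alt_sub_Ggen.
exact: rho_string_C_group.
Qed.
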